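(* Let $V_1=(1,b_1,c_1,d_1)$, $V_2=(1,b_2,c_2,d_1)$, $V_3=(0,0,0,d_3)$ in $\mathfrak{se}(2)\times\mathbb{R}$ with $d_3\neq 0$ and either $b_2\neq b_1$ or $c_1\neq c_2$. Define the neighborhood of the identity in $\mathrm{SE}(2)\times\mathbb{R}$ $$U=\big\{(\theta,x,y,z)\in\mathrm{SE}(2)\times\mathbb{R}\ \big|\ \|(c_1-c_2,b_1-b_2)\|^2\ge\max\{\|(x,y)\|^2,\ 2(1-\cos\theta)\|(b_1,c_1)\|^2\}\big\}.$$ Consider the map $\mathcal{IK}:U\subset\mathrm{SE}(2)\times\mathbb{R}\to\mathbb{R}^4$ whose components are $$\mathcal{IK}_1(\theta,x,y,z)=\operatorname{arctan2}\big(\rho,\sqrt{4-\rho^2}\big)+\operatorname{arctan2}(\alpha,\beta),$$ $$\mathcal{IK}_2(\theta,x,y,z)=\operatorname{arctan2}\big(2-\rho^2,\rho\sqrt{4-\rho^2}\big),$$ $$\mathcal{IK}_3(\theta,x,y,z)=\theta-\mathcal{IK}_1(\theta,x,y,z)-\mathcal{IK}_2(\theta,x,y,z),$$ $$\mathcal{IK}_4(\theta,x,y,z)=\frac{z-d_1\theta}{d_3},$$ where $\rho=\sqrt{\alpha^2+\beta^2}$ and $$\begin{bmatrix}\alpha\\ \beta\end{bmatrix}=\frac{1}{\|(c_1-c_2,b_1-b_2)\|^2}\begin{bmatrix}c_1-c_2&b_2-b_1\\ b_1-b_2&c_1-c_2\end{bmatrix}\left(\begin{bmatrix}x\\ y\end{bmatrix}-\begin{bmatrix}-c_1&b_1\\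 b_1&c_1\end{bmatrix}\begin{bmatrix}1-\cos\theta\\ \sin\theta\end{bmatrix}\right).$$ Then $\mathcal{IK}$ is a local right inverse of the map $\mathcal{FK}^{(1,2,1,3)}:\mathbb{R}^4\to\mathrm{SE}(2)\times\mathbb{R}$, $\mathcal{FK}^{(1,2,1,3)}(t_1,t_2,t_3,t_4)=\exp(t_1V_1)\exp(t_2V_2)\exp(t_3V_1)\exp(t_4V_3)$; that is, $\mathcal{FK}^{(1,2,1,3)}\circ\mathcal{IK}=\mathrm{id}_U:U\to U$.
   Context: $\mathrm{SE}(2)\times\mathbb{R}$ is the direct product of the matrix group $\mathrm{SE}(2)$ and the additive group $\mathbb{R}$, with Lie algebra $\mathfrak{se}(2)\times\mathbb{R}$. Elements of $\mathfrak{se}(2)\times\mathbb{R}$ are written $(a,b,c,d)=a e_\theta+b e_x+c e_y+d e_z$, where $e_z$ spans the $\mathbb{R}$ factor and $$e_\theta=\begin{bmatrix}0&-1&0\\ 1&0&0\\ 0&0&0\end{bmatrix},\quad e_x=\begin{bmatrix}0&0&1\\ 0&0&0\\ 0&0&0\end{bmatrix},\quad e_y=\begin{bmatrix}0&0&0\\ 0&0&1\\ 0&0&0\end{bmatrix}$$ span $\mathfrak{se}(2)$. Elements of $\mathrm{SE}(2)\times\mathbb{R}$ are written $(\theta,x,y,z)$, with $z\in\mathbb{R}$ and $(\theta,x,y)\equiv\begin{bmatrix}\cos\theta&-\sin\theta&x\\ \sin\theta&\cos\theta&y\\ 0&0&1\end{bmatrix}$. The angle $\theta$ is determined by the group element only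 modulo $2\pi$; in the formula for $\mathcal{IK}$, $\theta$ is a fixed choice of real representative (for instance in $(-\pi,\pi]$). $\exp$ is the exponential map, given component-wise by the matrix exponential on $\mathfrak{se}(2)$ and the identity $d\mapsto d$ on $\mathbb{R}$. $\|\cdot\|$ is the Euclidean norm. $\operatorname{arctan2}(x,y)$ denotes the arctangent of $y/x$ taking into account the quadrant of the point $(x,y)$ (i.e. the polar angle of $(x,y)$, in $(-\pi,\pi]$), with the convention $\operatorname{arctan2}(0,0)=0$; note the order of arguments. *)

(* Defs.v *)
From mathcomp Require Import all_boot all_order all_algebra.
From mathcomp Require Import all_classical all_reals all_analysis.

Set Implicit Arguments.
Unset Strict Implicit.
Unset Printing Implicit Defensive.

Import Order.TTheory GRing.Theory Num.Theory.
Import numFieldNormedType.Exports.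

Local Open Scope classical_set_scope.
Local Open Scope ring_scope.

Section Defs.
Context {R : realType}.

Definition seqmx m n (s : seq (seq R)) : 'M[R]_(m, n) :=
  \matrix_(i < m, j < n) (nth [::] s i)`_j.

Definition vec2 (x y : R) : 'cV[R]_2 := seqmx 2 1 [:: [:: x]; [:: y]].

(* The Euclidean norm; the library norm on matrices is the max norm. *)
Definition enorm n (v : 'cV[R]_n) : R := Num.sqrt (\sum_i v i 0 ^+ 2).

(* Polar angle of the point (x, y), in ]-pi, pi], with value 0 at (0, 0):
   the abscissa is the first argument. *)
Definition arctan2 (x y : R) : R :=
  if 0 < x then atan (y / x)
  else if x < 0 then
    if 0 <= y then atan (y / x) + pi else atan (y / x) - pi
  else if 0 < y then pi / 2
  else if y < 0 then - (pi / 2)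
  else 0.

Definition expmx n (A : 'M[R]_n.+1) : 'M[R]_n.+1 :=
  limn (series (fun k : nat => k`!%:R^-1 *: A ^+ k)).

Definition e_theta : 'M[R]_3 :=
  seqmx 3 3 [:: [:: 0; -1; 0]; [:: 1; 0; 0]; [:: 0; 0; 0]].
Definition e_x : 'M[R]_3 :=
  seqmx 3 3 [:: [:: 0; 0; 1]; [:: 0; 0; 0]; [:: 0; 0; 0]].
Definition e_y : 'M[R]_3 :=
  seqmx 3 3 [:: [:: 0; 0; 0]; [:: 0; 0; 1]; [:: 0; 0; 0]].

(* se(2) x R is represented inside 'M_3 * R^o, where R^o is R as a module over
   itself, and SE(2) x R inside 'M_3 * R. *)
Definition se2R (a b c d : R) : 'M[R]_3 * R^o :=
  (a *: e_theta + b *: e_x + c *: e_y, d).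

Definition SE2mx (theta x y : R) : 'M[R]_3 :=
  seqmx 3 3 [:: [:: cos theta; - sin theta; x];
                [:: sin theta;   cos theta; y];
                [:: 0;           0;         1]].

Definition SE2 : set 'M[R]_3 :=
  [set g | exists theta x y, g = SE2mx theta x y].

Definition SE2R : set ('M[R]_3 * R) := SE2 `*` [set: R].

(* The group law is additive on the second factor, unlike the product ring
   structure of 'M_3 * R. *)
Definition SE2R_mul (p q : 'M[R]_3 * R) : 'M[R]_3 * R :=
  (p.1 *m q.1, p.2 + q.2).

Definition SE2R_one : 'M[R]_3 * R := (1%:M, 0).

Definition SE2R_exp (V : 'M[R]_3 * R^o) : 'M[R]_3 * R := (expmx V.1, V.2).

Definition FK1213 (V1 V2 V3 : 'M[R]_3 * R^o) (t : 'rV[R]_4) : 'M[R]_3 * R :=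
  SE2R_mul (SE2R_mul (SE2R_mul
    (SE2R_exp (t 0 (inord 0) *: V1)) (SE2R_exp (t 0 (inord 1) *: V2)))
    (SE2R_exp (t 0 (inord 2) *: V1))) (SE2R_exp (t 0 (inord 3) *: V3)).

Definition IK_dom (b1 c1 b2 c2 : R) : set ('M[R]_3 * R) :=
  [set p | exists theta x y z, p = (SE2mx theta x y, z) /\
     Num.max (enorm (vec2 x y) ^+ 2)
             (2 * (1 - cos theta) * enorm (vec2 b1 c1) ^+ 2)
       <= enorm (vec2 (c1 - c2) (b1 - b2)) ^+ 2].

Definition IK_alphabeta (b1 c1 b2 c2 theta x y : R) : 'cV[R]_2 :=
  (enorm (vec2 (c1 - c2) (b1 - b2)) ^+ 2)^-1 *:
  (seqmx 2 2 [:: [:: c1 - c2; b2 - b1];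
                 [:: b1 - b2; c1 - c2]] *m
   (vec2 x y -
    seqmx 2 2 [:: [:: - c1; b1];
                  [:: b1;   c1]] *m vec2 (1 - cos theta) (sin theta))).

Definition IK_coord (b1 c1 b2 c2 d1 d3 theta x y z : R) : 'rV[R]_4 :=
  let ab := IK_alphabeta b1 c1 b2 c2 theta x y in
  let alpha := ab 0 0 in
  let beta := ab 1 0 in
  let rho := Num.sqrt (alpha ^+ 2 + beta ^+ 2) in
  let IK1 := arctan2 rho (Num.sqrt (4 - rho ^+ 2)) + arctan2 alpha beta in
  let IK2 := arctan2 (2 - rho ^+ 2) (rho * Num.sqrt (4 - rho ^+ 2)) in
  let IK3 := theta - IK1 - IK2 in
  let IK4 := (z - d1 * theta) / d3 in
  seqmx 1 4 [:: [:: IK1; IK2; IK3; IK4]].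

(* A choice, for each group element, of a real representative of its angle,
   which the group element determines only modulo 2 pi. *)
Definition angle_choice (ang : 'M[R]_3 * R -> R) : Prop :=
  forall p, SE2R p ->
    p.1 = SE2mx (ang p) (p.1 0 (inord 2)) (p.1 1 (inord 2)).

Definition IK (ang : 'M[R]_3 * R -> R) (b1 c1 b2 c2 d1 d3 : R)
    (p : 'M[R]_3 * R) : 'rV[R]_4 :=
  IK_coord b1 c1 b2 c2 d1 d3
    (ang p) (p.1 0 (inord 2)) (p.1 1 (inord 2)) p.2.

End Defs.

(* Main.v *)
(* Identify the plane with the complex numbers. For [V = (1, b, c)] the matrix
   [V] satisfies [V^3 = - V], so [exp (t V)] is the rotation by [t] about
   [w = i (b + i c)]. The first three factors therefore compose to a rotation
   by [t = t1 + t2 + t3] with translation part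
   [e^(i t1) (1 - e^(i t2)) (w2 - w1) + (1 - e^(i t)) w1]. Equating it with
   [x + i y] amounts to [e^(i t1) (1 - e^(i t2)) = alpha + i beta], which the
   closed forms for [t1] and [t2] solve as soon as [rho <= 2]; the definition of
   [U] guarantees this bound through [|u - v|^2 <= 2 |u|^2 + 2 |v|^2]. *)
Require Import Defs.
From mathcomp Require Import all_boot all_order all_algebra.
From mathcomp Require Import all_classical all_reals all_analysis.
From mathcomp Require Import ring lra.
Import Order.TTheory GRing.Theory Num.Theory.
Import numFieldNormedType.Exports.
Local Open Scope classical_set_scope.
Local Open Scope ring_scope.

(** * Exponential of a matrix with [A ^+ 3 = - A] *)

Lemma expr_cubeN (R : nzRingType) (A : lalgType R) (a : A) (m : nat) :
  a ^+ 3 = - a ->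
  a ^+ m.*2.+1 = (-1) ^+ m *: a /\ a ^+ m.*2.+2 = (-1) ^+ m *: a ^+ 2.
Proof.
move=> a3; elim: m => [|m [IH1 IH2]]; first by rewrite !scale1r.
have odd_step : a ^+ m.+1.*2.+1 = (-1) ^+ m.+1 *: a.
  by rewrite doubleS exprSr IH2 -scalerAl -exprSr a3 exprSr mulrN1 scalerN scaleNr.
by split=> //; rewrite exprSr odd_step -scalerAl -expr2.
Qed.

Lemma exp_term_cubeN (R : realType) (n : nat) (A : 'M[R]_n.+1) (t : R)
    (k : nat) :
  A ^+ 3 = - A ->
  k.+1`!%:R^-1 *: (t *: A) ^+ k.+1 =
  sin_coeff t k.+1 *: A - cos_coeff t k.+1 *: A ^+ 2.
Proof.
move=> A3; have [Aodd Aeven] := expr_cubeN _ _ _ k./2 A3.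
rewrite exprZn scalerA /sin_coeff /cos_coeff.
rewrite /= uphalf_half -exprnP.
have := odd_double_half k; case: (odd k) => /= kE; rewrite !(mul0r, mul1r, scale0r).
- rewrite sub0r -{3}kE Aeven scalerA -scaleNr; congr (_ *: _).
  by rewrite add1n [(-1) ^+ _.+1]exprS mulN1r !mulNr opprK mulrC mulrA mulrAC.
- rewrite subr0 -{3}kE Aodd scalerA; congr (_ *: _).
  by rewrite mulrC mulrA mulrAC.
Qed.

(** Powers of [A] cycle through [A], [A ^+ 2], [- A], [- A ^+ 2], so the odd terms of the series sum
    to the sine and the even ones to the cosine. *)
Lemma expmx_cubeN (R : realType) (n : nat) (A : 'M[R]_n.+1) (t : R) :
  A ^+ 3 = - A ->
  expmx (t *: A) = 1 + sin t *: A + (1 - cos t) *: A ^+ 2.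
Proof.
move=> A3; apply: cvg_lim; first exact: norm_hausdorff.
rewrite -cvg_shiftS.
(* The term of index 0 is [1], whereas the sine and cosine pattern would give [- A ^+ 2] there; the
   constant [1 + A ^+ 2] corrects this. The shift to [m.+1] makes every partial sum contain that
   term. *)
rewrite [X in X @ \oo --> _](_ : _ = (fun m => (1 + A ^+ 2)
    + (series (sin_coeff t) m.+1 *: A - series (cos_coeff t) m.+1 *: A ^+ 2))).
  have -> : 1 + sin t *: A + (1 - cos t) *: A ^+ 2 =
      (1 + A ^+ 2) + (sin t *: A - cos t *: A ^+ 2).
    by rewrite scalerBl scale1r -!addrA; congr (_ + _); rewrite addrCA.
  have cvg_sin : series (sin_coeff t) m.+1 @[m --> \oo] --> sin t.
    rewrite (cvg_shiftS (series (sin_coeff t))) unlock.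
    exact: is_cvg_series_sin_coeff.
  have cvg_cos : series (cos_coeff t) m.+1 @[m --> \oo] --> cos t.
    rewrite (cvg_shiftS (series (cos_coeff t))) unlock.
    exact: is_cvg_series_cos_coeff.
  by apply: cvgD; [exact: cvg_cst | apply: cvgB; exact: cvgZr_tmp].
apply/funext => m; rewrite /series /=; elim: m => [|m IH].
  rewrite !big_nat1 /sin_coeff /cos_coeff /= !expr0 !mul0r fact0 expr0z !mul1r invr1.
  by rewrite !scale1r scale0r sub0r addrK.
rewrite big_nat_recr //= IH exp_term_cubeN // -addrA; congr (_ + _).
by rewrite (big_nat_recr m.+1) // (big_nat_recr m.+1) //= !scalerDl opprD addrACA.
Qed.

(** * Polar coordinates and the closed forms for the angles *)

Section Arctan2.
Variable R : realType.
Implicit Types x y : R.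

Lemma sin_atan_cos (u : R) : sin (atan u) = u * cos (atan u).
Proof.
rewrite -{2}[u]atanK /tan divfK // cos_atan invr_eq0 sqrtr_eq0 -ltNge.
by rewrite ltr_pwDl // sqr_ge0.
Qed.

Lemma norm_cos_atan x y : x != 0 ->
  Num.sqrt (x ^+ 2 + y ^+ 2) * cos (atan (y / x)) = `|x|.
Proof.
move=> x0; have -> : x ^+ 2 + y ^+ 2 = x ^+ 2 * (1 + (y / x) ^+ 2) by field.
rewrite sqrtrM ?sqr_ge0 // sqrtr_sqr cos_atan mulfK //.
by rewrite sqrtr_eq0 -ltNge ltr_pwDl // sqr_ge0.
Qed.

Lemma polar_arctan2 x y :
  Num.sqrt (x ^+ 2 + y ^+ 2) * cos (arctan2 x y) = x /\
  Num.sqrt (x ^+ 2 + y ^+ 2) * sin (arctan2 x y) = y.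
Proof.
rewrite /arctan2; have [x0|x0|->] := ltrgt0P x.
- rewrite sin_atan_cos mulrCA norm_cos_atan ?gt_eqF // gtr0_norm //.
  by rewrite divfK ?gt_eqF.
(* Shifting by [pi] or by [- pi] negates both sine and cosine, so one argument serves both signs of
   [y]. *)
- have polar_neg z : cos z = - cos (atan (y / x)) ->
      sin z = - sin (atan (y / x)) ->
      Num.sqrt (x ^+ 2 + y ^+ 2) * cos z = x /\
      Num.sqrt (x ^+ 2 + y ^+ 2) * sin z = y.
    move=> -> ->; rewrite sin_atan_cos !mulrN mulrCA.
    by rewrite norm_cos_atan ?lt_eqF // ltr0_norm // mulrN !opprK divfK ?lt_eqF.
  case: ifP => _; apply: polar_neg.
  + by rewrite cosDpi.
  + by rewrite sinDpi.
  + by rewrite cosB cospi sinpi mulr0 addr0 mulrN1.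
  + by rewrite sinB cospi sinpi mulr0 subr0 mulrN1.
- rewrite expr0n add0r sqrtr_sqr; have [y0|y0|->] := ltrgt0P y.
  + by rewrite cos_pihalf sin_pihalf mulr0 mulr1.
  + by rewrite cosN sinN cos_pihalf sin_pihalf mulr0 mulrN1 opprK.
  + by rewrite cos0 sin0 !mul0r.
Qed.

End Arctan2.

(** Let [a] and [u] be the two summands of [t1], and [s = sqrt (4 - rho^2)]. Then
    [e^(i a) = (rho + i s) / 2] and [1 - e^(i t2) = rho (rho - i s) / 2 = rho e^(- i a)], whence
    [e^(i t1) (1 - e^(i t2)) = rho e^(i u) = alpha + i beta]. *)
Lemma IK_angles (R : realType) (alpha beta : R) :
  let rho := Num.sqrt (alpha ^+ 2 + beta ^+ 2) in
  let t1 := arctan2 rho (Num.sqrt (4 - rho ^+ 2)) + arctan2 alpha beta in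
  let t2 := arctan2 (2 - rho ^+ 2) (rho * Num.sqrt (4 - rho ^+ 2)) in
  alpha ^+ 2 + beta ^+ 2 <= 4 ->
  cos t1 - cos (t1 + t2) = alpha /\ sin t1 - sin (t1 + t2) = beta.
Proof.
move=> rho t1 t2 le4.
have rho2 : rho ^+ 2 = alpha ^+ 2 + beta ^+ 2.
  by rewrite sqr_sqrtr // addr_ge0 // sqr_ge0.
rewrite /t1 /t2 {t1 t2}; set s := Num.sqrt (4 - _).
have s2 : s ^+ 2 = 4 - rho ^+ 2 by rewrite sqr_sqrtr // rho2 subr_ge0.
have sqrt4 : Num.sqrt 4 = 2 :> R.
  by rewrite (_ : 4 = 2 ^+ 2) ?sqrtr_sqr ?ger0_norm //; ring.
have [cu su] := polar_arctan2 _ alpha beta; rewrite -/rho in cu su.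
have [ca sa] := polar_arctan2 _ rho s.
have [cb sb] := polar_arctan2 _ (2 - rho ^+ 2) (rho * s).
(* The points [(rho, s)] and [(2 - rho^2, rho s)] both lie on the circle of radius 2. *)
have E1 : rho ^+ 2 + s ^+ 2 = 4 by rewrite s2; ring.
have E2 : (2 - rho ^+ 2) ^+ 2 + (rho * s) ^+ 2 = 4.
  by rewrite exprMn s2; ring.
rewrite E1 sqrt4 in ca sa; rewrite E2 sqrt4 in cb sb.
move: cu su ca sa cb sb.
set u := arctan2 alpha beta; set a := arctan2 rho s; set b := arctan2 _ (rho * s).
move=> cu su ca sa cb sb.
have {}ca : cos a = rho / 2 by rewrite -ca; field.
have {}sa : sin a = s / 2 by rewrite -sa; field.
have {}cb : cos b = (2 - rho ^+ 2) / 2 by rewrite -cb; field.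
have {}sb : sin b = rho * s / 2 by rewrite -sb; field.
rewrite !(cosD, sinD) ca sa cb sb.
have s2' : s * s = 4 - rho ^+ 2 by rewrite -expr2.
split.
- rewrite -[RHS]cu.
  transitivity (rho * cos u * (rho ^+ 2 + s * s) / 4); first by field.
  by rewrite s2'; field.
- rewrite -[RHS]su.
  transitivity (rho * sin u * (rho ^+ 2 + s * s) / 4); first by field.
  by rewrite s2'; field.
Qed.

(** * Computations in SE(2) and the inversion formula *)

Section SE2.
Variable R : realType.
Implicit Types a b c d t x y : R.

Lemma seqmx_mul3 (s t u : seq (seq R)) :
  (forall i j : nat, (i < 3)%N -> (j < 3)%N ->
   (nth [::] s i)`_0 * (nth [::] t 0)`_j + (nth [::] s i)`_1 * (nth [::] t 1)`_j
    + (nth [::] s i)`_2 * (nth [::] t 2)`_j = (nth [::] u i)`_j) ->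
  seqmx 3 3 s *m seqmx 3 3 t = seqmx 3 3 u.
Proof.
move=> stu; apply/matrixP => i j.
rewrite !mxE !big_ord_recl big_ord0 !mxE /= addr0 addrA; exact: stu.
Qed.

Lemma se2_seqmx a b c :
  a *: e_theta + b *: e_x + c *: e_y =
  seqmx 3 3 [:: [:: 0; - a; b]; [:: a; 0; c]; [:: 0; 0; 0]] :> 'M[R]_3.
Proof.
apply/matrixP => -[[|[|[|//]]] ?] [[|[|[|//]]] ?]; rewrite !mxE /=; ring.
Qed.

Lemma se2_sqr b c :
  (1 *: e_theta + b *: e_x + c *: e_y) ^+ 2 =
  seqmx 3 3 [:: [:: -1; 0; - c]; [:: 0; -1; b]; [:: 0; 0; 0]] :> 'M[R]_3.
Proof.
rewrite se2_seqmx expr2; apply: seqmx_mul3.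
by move=> [|[|[|//]]] [|[|[|//]]] //= _ _; ring.
Qed.

Lemma se2_cube b c (V := 1 *: e_theta + b *: e_x + c *: e_y : 'M[R]_3) :
  V ^+ 3 = - V.
Proof.
rewrite exprS se2_sqr /V se2_seqmx -mulmxE.
rewrite (seqmx_mul3 _ _ [:: [:: 0; 1; - b]; [:: - 1; 0; - c]; [:: 0; 0; 0]]).
  by apply/matrixP => -[[|[|[|//]]] ?] [[|[|[|//]]] ?]; rewrite !mxE /=; ring.
by move=> [|[|[|//]]] [|[|[|//]]] //= _ _; ring.
Qed.

(** The translation part is [(1 - e^(i t)) w] with [w = - c + i b], the fixed point of the
    rotation. *)
Lemma expmx_se2 b c t :
  expmx (t *: (1 *: e_theta + b *: e_x + c *: e_y)) =
  SE2mx t (b * sin t - c * (1 - cos t)) (b * (1 - cos t) + c * sin t).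
Proof.
rewrite expmx_cubeN ?se2_cube // se2_sqr se2_seqmx.
by apply/matrixP => -[[|[|[|//]]] ?] [[|[|[|//]]] ?]; rewrite !mxE /=; ring.
Qed.

Lemma expmx_0 : expmx 0 = 1%:M :> 'M[R]_3.
Proof.
have := @expmx_cubeN R 2 0 0; rewrite scaler0 => ->.
  by rewrite sin0 cos0 subrr !scale0r !addr0.
by rewrite expr0n oppr0.
Qed.

Lemma SE2mx_mul t x y t' x' y' :
  SE2mx t x y *m SE2mx t' x' y' =
  SE2mx (t + t') (x + cos t * x' - sin t * y') (y + sin t * x' + cos t * y').
Proof.
apply: seqmx_mul3; rewrite cosD sinD.
by move=> [|[|[|//]]] [|[|[|//]]] //= _ _; ring.
Qed.

Lemma enorm_vec2 x y : enorm (vec2 x y) ^+ 2 = x ^+ 2 + y ^+ 2.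
Proof.
rewrite /enorm !big_ord_recl big_ord0 !mxE /= addr0 sqr_sqrtr //.
by rewrite addr_ge0 // sqr_ge0.
Qed.

(** [X + i Y] is [x + i y] minus [(1 - e^(i t)) w1]. Since [w2 - w1 = (c1 - c2) + i (b2 - b1)] has
    squared modulus [N], the formulas compute [alpha + i beta = (X + i Y) / (w2 - w1)]. *)
Lemma IK_alphabetaE b1 c1 b2 c2 t x y
    (X := x + c1 * (1 - cos t) - b1 * sin t)
    (Y := y - b1 * (1 - cos t) - c1 * sin t)
    (N := (c1 - c2) ^+ 2 + (b1 - b2) ^+ 2) :
  let ab := IK_alphabeta b1 c1 b2 c2 t x y in
  ab 0 0 = ((c1 - c2) * X + (b2 - b1) * Y) / N /\
  ab 1 0 = ((b1 - b2) * X + (c1 - c2) * Y) / N.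
Proof.
rewrite /IK_alphabeta /= enorm_vec2 -/N.
by split; rewrite !(mxE, big_ord_recl, big_ord0) /= /X /Y; ring.
Qed.

(* [p + i q = e^(i t1) (1 - e^(i t2))] *)
Lemma FK1213E b1 c1 b2 c2 d1 d3 (T : 'rV[R]_4)
    (t1 := T 0 (inord 0)) (t2 := T 0 (inord 1)) (t3 := T 0 (inord 2))
    (t := t1 + t2 + t3)
    (p := cos t1 - cos (t1 + t2)) (q := sin t1 - sin (t1 + t2)) :
  FK1213 (se2R 1 b1 c1 d1) (se2R 1 b2 c2 d1) (se2R 0 0 0 d3) T =
  (SE2mx t
     ((c1 - c2) * p - (b2 - b1) * q + b1 * sin t - c1 * (1 - cos t))
     ((c1 - c2) * q + (b2 - b1) * p + b1 * (1 - cos t) + c1 * sin t),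
   t * d1 + T 0 (inord 3) * d3).
Proof.
rewrite /FK1213 /SE2R_mul /SE2R_exp /se2R /= -/t1 -/t2 -/t3 !expmx_se2.
rewrite !scale0r !addr0 scaler0 expmx_0 mulmx1 !SE2mx_mul.
congr pair; last by rewrite /t !mulrDl.
rewrite /p /q /t !(cosD, sinD); congr SE2mx; ring.
Qed.

Lemma sqr_norm_sub_rotation_le b1 c1 t x y
    (X := x + c1 * (1 - cos t) - b1 * sin t)
    (Y := y - b1 * (1 - cos t) - c1 * sin t) :
  X ^+ 2 + Y ^+ 2 <=
  2 * (x ^+ 2 + y ^+ 2) + 2 * (2 * (1 - cos t) * (b1 ^+ 2 + c1 ^+ 2)).
Proof.
pose u := b1 * sin t - c1 * (1 - cos t).
pose v := b1 * (1 - cos t) + c1 * sin t.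
(* [u + i v = (1 - e^(i t)) w1], and [|1 - e^(i t)|^2 = 2 (1 - cos t)]. *)
have -> : 2 * (1 - cos t) * (b1 ^+ 2 + c1 ^+ 2) = u ^+ 2 + v ^+ 2.
  rewrite /u /v; have := cos2Dsin2 t; move: (cos t) (sin t) => C S CS.
  have -> : (b1 * S - c1 * (1 - C)) ^+ 2 + (b1 * (1 - C) + c1 * S) ^+ 2 =
     (b1 ^+ 2 + c1 ^+ 2) * (1 - 2 * C + (C ^+ 2 + S ^+ 2)) by ring.
  by rewrite CS; ring.
have -> : X = x - u by rewrite /X /u; ring.
have -> : Y = y - v by rewrite /Y /v; ring.
have := sqr_ge0 (x + u); have := sqr_ge0 (y + v); lra.
Qed.

Lemma FK_IK b1 c1 b2 c2 d1 d3 t x y z :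
  d3 != 0 -> 0 < (c1 - c2) ^+ 2 + (b1 - b2) ^+ 2 ->
  x ^+ 2 + y ^+ 2 <= (c1 - c2) ^+ 2 + (b1 - b2) ^+ 2 ->
  2 * (1 - cos t) * (b1 ^+ 2 + c1 ^+ 2) <= (c1 - c2) ^+ 2 + (b1 - b2) ^+ 2 ->
  FK1213 (se2R 1 b1 c1 d1) (se2R 1 b2 c2 d1) (se2R 0 0 0 d3)
    (IK_coord b1 c1 b2 c2 d1 d3 t x y z) = (SE2mx t x y, z).
Proof.
move=> d30 N0 xyN bcN; rewrite FK1213E /IK_coord; cbv zeta.
have [-> ->] := IK_alphabetaE b1 c1 b2 c2 t x y.
rewrite !mxE !inordK //=.
have := sqr_norm_sub_rotation_le b1 c1 t x y; cbv zeta.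
set X := x + _ - _; set Y := y - _ - _; set N := _ + (b1 - b2) ^+ 2 in N0 xyN bcN *.
move=> XYN; set alpha := (_ / N) ; set beta := (_ / N).
(* Dividing by [w2 - w1] divides the squared norm by [N], and the two bounds defining the domain
   give [X^2 + Y^2 <= 2 N + 2 N]. *)
have ab4 : alpha ^+ 2 + beta ^+ 2 <= 4.
  have -> : alpha ^+ 2 + beta ^+ 2 = (X ^+ 2 + Y ^+ 2) / N.
    by rewrite /alpha /beta /N; field; rewrite gt_eqF.
  by rewrite ler_pdivrMr //; lra.
have [-> ->] := IK_angles _ _ _ ab4.
(* The angles add up to [t] as reals, not just modulo [2 pi]; the [z] component needs this to cancel
   [d1 * t]. *)
have angle_sum u v : u + v + (t - u - v) = t by ring.
rewrite angle_sum.
congr (SE2mx _ _ _, _).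
- transitivity (X + b1 * sin t - c1 * (1 - cos t)); last by rewrite /X; ring.
  by congr (_ + _ - _); rewrite /alpha /beta /N; field; rewrite gt_eqF.
- transitivity (Y + b1 * (1 - cos t) + c1 * sin t); last by rewrite /Y; ring.
  by congr (_ + _ + _); rewrite /alpha /beta /N; field; rewrite gt_eqF.
- by field.
Qed.

End SE2.

(** * The neighborhood of the identity and the conclusion *)

Lemma cvg_fst_coord (R : realType) (m n : nat) (p : 'M[R]_(m, n) * R)
    (i : 'I_m) (j : 'I_n) :
  (q : 'M[R]_(m, n) * R).1 i j @[q --> p] --> p.1 i j.
Proof.
apply: (@continuous_comp _ _ _ fst (fun M : 'M[R]_(m, n) => M i j) p).
  exact: cvg_fst.
exact: coord_continuous.
Qed.

Lemma IK_dom_gt0 (R : realType) (b1 c1 b2 c2 : R) :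
  b2 != b1 \/ c1 != c2 -> 0 < (c1 - c2) ^+ 2 + (b1 - b2) ^+ 2.
Proof.
case=> [b12|c12].
  by rewrite ltr_wpDl ?sqr_ge0 // exprn_even_gt0 //= subr_eq0 eq_sym.
by rewrite ltr_pwDl ?sqr_ge0 // exprn_even_gt0 //= subr_eq0.
Qed.

Lemma IK_dom_SE2R (R : realType) (b1 c1 b2 c2 : R) :
  IK_dom b1 c1 b2 c2 `<=` SE2R.
Proof. by move=> _ [t [x [y [z [-> _]]]]]; split=> //; exists t, x, y. Qed.

(** Both bounded quantities are continuous in the matrix entries, with [cos t] read off as the entry
    at [0 0], and vanish at the identity, while the bound is positive. *)
Lemma nbhs_IK_dom (R : realType) (b1 c1 b2 c2 : R) :
  0 < (c1 - c2) ^+ 2 + (b1 - b2) ^+ 2 ->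
  within SE2R (nbhs SE2R_one) (IK_dom b1 c1 b2 c2).
Proof.
set N := _ + _ => N0; pose g0 : 'M[R]_3 * R := SE2R_one.
have cvg_xy : (p : 'M[R]_3 * R).1 0 (inord 2) ^+ 2 + p.1 1 (inord 2) ^+ 2
    @[p --> g0] --> (0 : R).
  rewrite [X in _ --> X] (_ : 0 = g0.1 0 (inord 2) ^+ 2 + g0.1 1 (inord 2) ^+ 2).
    by apply: cvgD; apply: cvgM; exact: cvg_fst_coord.
  by rewrite !mxE -!val_eqE /= !inordK //= expr0n addr0.
have cvg_cos : 2 * (1 - (p : 'M[R]_3 * R).1 0 0) * (b1 ^+ 2 + c1 ^+ 2)
    @[p --> g0] --> (0 : R).
  rewrite [X in _ --> X] (_ : 0 = 2 * (1 - g0.1 0 0) * (b1 ^+ 2 + c1 ^+ 2)).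
    apply: cvgM; last exact: cvg_cst.
    apply: cvgM; first exact: cvg_cst.
    by apply: cvgB; [exact: cvg_cst | exact: cvg_fst_coord].
  by rewrite !mxE subrr mulr0 mul0r.
have near_xy := cvgr_le _ cvg_xy _ N0; have near_cos := cvgr_le _ cvg_cos _ N0.
rewrite /within /= -/g0; near=> p => -[[t [x [y pE]]] _].
exists t, x, y, p.2; rewrite -pE -surjective_pairing; split=> //.
rewrite !enorm_vec2 ge_max; apply/andP; split.
- have -> : x = p.1 0 (inord 2) by rewrite pE !mxE inordK.
  have -> : y = p.1 1 (inord 2) by rewrite pE !mxE inordK.
  by near: p; exact: near_xy.
- have -> : cos t = p.1 0 0 by rewrite pE !mxE.
  by near: p; exact: near_cos.
Unshelve. all: by end_near.
Qed.

Theorem mainTheorem6 (R : realType) (b1 c1 b2 c2 d1 d3 : R)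
    (ang : 'M[R]_3 * R -> R) :
  d3 != 0 ->
  b2 != b1 \/ c1 != c2 ->
  angle_choice ang ->
  let V1 := se2R 1 b1 c1 d1 in
  let V2 := se2R 1 b2 c2 d1 in
  let V3 := se2R 0 0 0 d3 in
  let U := IK_dom b1 c1 b2 c2 in
  [/\ U `<=` SE2R,
      within SE2R (nbhs SE2R_one) U,
      (forall t : 'rV[R]_4, SE2R (FK1213 V1 V2 V3 t)) &
      (forall p, U p -> FK1213 V1 V2 V3 (IK ang b1 c1 b2 c2 d1 d3 p) = p)].
Proof.
move=> d30 neq angP V1 V2 V3 U; split.
- exact: IK_dom_SE2R.
- exact/nbhs_IK_dom/IK_dom_gt0.
- by move=> T; rewrite FK1213E; split=> //; eexists _, _, _.
- move=> p Up.
  have pE := angP _ (@IK_dom_SE2R _ _ _ _ _ _ Up).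
  (* The angle witnessing [U p] may differ from [ang p] by a multiple of [2 pi]; the condition sees
     only its cosine, which is a matrix entry. *)
  have cosE : cos (ang p) = p.1 0 0 by rewrite pE !mxE.
  rewrite /IK; suff [] : p.1 0 (inord 2) ^+ 2 + p.1 1 (inord 2) ^+ 2
        <= (c1 - c2) ^+ 2 + (b1 - b2) ^+ 2 /\
      2 * (1 - cos (ang p)) * (b1 ^+ 2 + c1 ^+ 2)
        <= (c1 - c2) ^+ 2 + (b1 - b2) ^+ 2.
    by move=> xyN bcN; rewrite FK_IK ?IK_dom_gt0 // -pE -surjective_pairing.
  rewrite cosE; case: Up => [t [x [y [z [-> ]]]]].
  by rewrite !enorm_vec2 ge_max !mxE !inordK //= => /andP[].
Qed.
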